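(* Let $r\ge1$ and $s\ge2$, and let $a^r$ denote $r$ copies of $a$. Define the following patterns of length $s(r+1)$: $Q_1=s\,0^r\,(s-1)\,0^r\cdots 1\,0^r$ (concatenation of the blocks $i\,0^r$ for $i=s,s-1,\dots,1$); $Q_2=s\,(s-1)^r\,s\,(s-2)^r\,s\cdots s\,1^r\,s\,0^r$ (concatenation of the blocks $s\,i^r$ for $i=s-1,s-2,\dots,0$); $Q_3=s\,(s-1)^r(s-1)\,(s-2)^r(s-2)\cdots1^r1\,0^r$ (the entry $s$, followed by the blocks $i^r\,i$ for $i=s-1,\dots,1$, followed by $0^r$). Then the consecutive patterns $Q_1,Q_2,Q_3$ are pairwise super-strongly Wilf equivalent.
   Context: An inversion sequence of length $n$ is an integer sequence $e=e_1e_2\dots e_n$ with $0\le e_i<i$ for all $i$; $\mathbf{I}_n$ denotes the set of these. The reduction of an integer word $w$ is obtained by replacing every occurrence of the $i$-th smallest distinct value of $w$ by $i-1$. For a pattern $p$ of length $m$, $\mathrm{Em}(p,e)$ is the set of positions $i$ such that the reduction of $e_i\dots e_{i+m-1}$ equals $p$. Two patterns are super-strongly Wilf equivalent if $|\{e\in\mathbf{I}_n:\mathrm{Em}(p,e)=T\}|=|\{e\in\mathbf{I}_n:\mathrm{Em}(p',e)=T\}|$ for all $n$ and all $T\subseteq[n]$. *)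

(* Defs.v *)
From mathcomp Require Import all_boot.
Set Implicit Arguments. Unset Strict Implicit. Unset Printing Implicit Defensive.

Definition reduction (w : seq nat) : seq nat :=
  map (fun x => index x (sort leq (undup w))) w.

(* Inversion sequences of length n, encoded as n-tuples over 'I_n; entry at
   0-based index i is e_{i+1}, and the condition e_{i+1} < i+1 is e_{i+1} <= i. *)
Definition word n (t : n.-tuple 'I_n) : seq nat := map (@nat_of_ord n) t.

Definition is_invseq n (t : n.-tuple 'I_n) : bool :=
  [forall i : 'I_n, (val (tnth t i) <= val i)%N].

(* Em(p,e): positions (0-based i : 'I_n, standing for position i+1) at which
   the window e_{i+1} ... e_{i+m} of length m = size p reduces to p.
   Windows running past the end are shorter than p, hence never match. *)
Definition Em n (p : seq nat) (e : seq nat) : {set 'I_n} :=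
  [set i : 'I_n | reduction (take (size p) (drop i e)) == p].

Definition num_with_Em n (p : seq nat) (T : {set 'I_n}) : nat :=
  #|[set t : n.-tuple 'I_n | is_invseq t && (Em n p (word t) == T)]|.

Definition super_strongly_Wilf_equiv (p q : seq nat) : Prop :=
  forall (n : nat) (T : {set 'I_n}), num_with_Em p T = num_with_Em q T.

Definition Q1 (r s : nat) : seq nat :=
  flatten [seq i :: nseq r 0 | i <- rev (iota 1 s)].
Definition Q2 (r s : nat) : seq nat :=
  flatten [seq s :: nseq r i | i <- rev (iota 0 s)].
Definition Q3 (r s : nat) : seq nat :=
  s :: flatten [seq nseq r i ++ [:: i] | i <- rev (iota 1 s.-1)] ++ nseq r 0.

(* Main.v *)
Require Import Defs.
From mathcomp Require Import all_boot.
From mathcomp Require Import zify.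
Set Implicit Arguments. Unset Strict Implicit. Unset Printing Implicit Defensive.

(** By inclusion-exclusion it is enough to count the inversion sequences with
  [T \subset Em p e]. Cut every window at a position of [T] into blocks (a head
  followed by r tail entries), and call a block linked if some window contains
  both it and the next block. For each of the three patterns the inclusion says
  that in every block the tail is constant and below the head, together with one
  relation between each linked block and its successor: for Q1 the tails agree
  and the heads decrease, for Q2 the heads agree and the tails decrease, for Q3
  the next head equals the tail. Any of these systems forces the blocks to be
  disjoint, except that the last entry of an unlinked block may be the head of
  another one. The systems of Q1 and Q2 are each turned into that of Q3, and back,
  by reindexing e: Q1 -> Q3 moves the next head into the tail of a linked block,
  and Q3 -> Q1 reads the last tail of the chain; Q2 -> Q3 moves the tail of a
  linked block into the next head, and Q3 -> Q2 reads the first head of the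
  chain. *)

(** * Inclusion-exclusion over sets of occurrences *)

(** Downward induction on [T]: the superset count is the exact count plus the exact counts of all
    strictly larger sets, and those agree by induction. *)
Lemma card_exact_of_superset (X I : finType) (A : {set X}) (f g : X -> {set I}) :
    (forall T : {set I}, #|[set x in A | T \subset f x]| = #|[set x in A | T \subset g x]|) ->
  forall T : {set I}, #|[set x in A | f x == T]| = #|[set x in A | g x == T]|.
Proof.
move=> H T; move: {2}#|~: T| (leqnn #|~: T|) => k; elim: k T => [|k IH] T kT.
  have TT : T = setT.
    by apply/setC_inj/eqP; rewrite setCT -cards_eq0 -leqn0.
  have E (h : X -> {set I}) : [set x in A | h x == T] = [set x in A | T \subset h x].
    by apply/setP=> x; rewrite !inE TT subTset.
  by rewrite !E.
have D (h : X -> {set I}) :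
    #|[set x in A | T \subset h x]| =
    #|[set x in A | h x == T]| + \sum_(S : {set I} | T \proper S) #|[set x in A | h x == S]|.
  transitivity (\sum_(S : {set I} | T \subset S) #|[set x in A | h x == S]|).
    rewrite -sum1_card (partition_big h (fun S : {set I} => T \subset S)) /=; last first.
      by move=> x; rewrite inE => /andP[].
    apply: eq_bigr => S TS; rewrite -sum1_card; apply: eq_bigl => x.
    by rewrite !inE; case: eqP => [->|_]; rewrite ?TS ?andbT ?andbF.
  rewrite (bigD1 T) //=; congr addn; apply: eq_bigl => S.
  by rewrite properEneq eq_sym andbC.
have := H T; rewrite !D.
have -> : \sum_(S : {set I} | T \proper S) #|[set x in A | f x == S]| =
          \sum_(S : {set I} | T \proper S) #|[set x in A | g x == S]|.
  apply: eq_bigr => S TS; apply: IH.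
  have : #|~: S| < #|~: T| by apply: proper_card; rewrite properC.
  by move: kT; lia.
by move/eqP; rewrite eqn_add2r => /eqP.
Qed.

(** * Reduction and relative order *)

Lemma nth_sort_reduction (w : seq nat) x : x < size w ->
  nth 0 (sort leq (undup w)) (nth 0 (reduction w) x) = nth 0 w x.
Proof.
by move=> xw; rewrite /reduction (nth_map 0) // nth_index // mem_sort mem_undup mem_nth.
Qed.

Lemma ltn_reduction (w : seq nat) x y : x < size w -> y < size w ->
  (nth 0 (reduction w) x < nth 0 (reduction w) y) = (nth 0 w x < nth 0 w y).
Proof.
set S := sort leq (undup w).
have sS : sorted ltn S.
  by rewrite ltn_sorted_uniq_leq sort_uniq undup_uniq sort_sorted //; exact: leq_total.
have inS z : z < size w -> nth 0 (reduction w) z < size S.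
  move=> zw; rewrite /reduction (nth_map 0) // index_mem mem_sort mem_undup.
  exact: mem_nth.
move=> xw yw.
rewrite -(nth_sort_reduction xw) -(nth_sort_reduction yw).
have mono i j : i < size S -> j < size S -> i < j -> nth 0 S i < nth 0 S j.
  by move=> iS jS; apply: (sorted_ltn_nth ltn_trans 0 sS); rewrite inE.
case: (ltngtP (nth 0 (reduction w) x) (nth 0 (reduction w) y)) => [lt|gt|->].
- by rewrite mono // inS.
- by apply/esym/negbTE; rewrite -leqNgt ltnW // mono // inS.
- by rewrite ltnn.
Qed.

(** Since [p] uses exactly the letters 0, ..., s, the sorted distinct values of [map v p] are v 0,
    ..., v s, where v x has index x. *)
Lemma reduction_homo (p : seq nat) (v : nat -> nat) s :
    (forall i, (i \in p) = (i <= s)) ->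
    (forall i j, i < j -> j <= s -> v i < v j) ->
  reduction (map v p) = p.
Proof.
move=> ps hv.
have vinj : {in [pred i | i <= s] &, injective v}.
  move=> i j; rewrite !inE => si sj E; apply/eqP; case: ltngtP => // lt.
    by have := hv _ _ lt sj; rewrite E ltnn.
  by have := hv _ _ lt si; rewrite E ltnn.
have -> : reduction (map v p) =
   map (fun x => index (v x) (map v (iota 0 s.+1))) p.
  rewrite /reduction -map_comp; apply/eq_map => x; rewrite [LHS]/=; congr (index (v x) _).
  apply: (@irr_sorted_eq _ ltn ltn_trans ltnn).
  - by rewrite ltn_sorted_uniq_leq sort_uniq undup_uniq sort_sorted //; exact: leq_total.
  - apply: (homo_sorted_in (P := [pred i | i <= s])) (iota_ltn_sorted 0 s.+1).
    + by move=> i j _ js ij; apply: hv.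
    + by apply/allP=> i; rewrite mem_iota.
  - move=> y; rewrite mem_sort mem_undup; apply/mapP/mapP=> -[i ip ->]; exists i => //.
      by rewrite mem_iota /= add0n ltnS -ps.
    by rewrite ps; move: ip; rewrite mem_iota.
rewrite -[RHS]map_id; apply/eq_in_map => x xp; rewrite ps in xp.
have xs : x \in iota 0 s.+1 by rewrite mem_iota.
have vinj' : {in iota 0 s.+1 &, injective v}.
  by move=> i j; rewrite !mem_iota /= !add0n !ltnS; apply: vinj.
rewrite -[RHS](nth_index_map 0 vinj' xs) nth_iota //.
by rewrite -[X in _ < X](size_iota 0 s.+1) -(size_map v) index_mem map_f.
Qed.

(** * Systems of linked blocks *)

Section Blocks.

Variables (r n : nat) (B L : pred nat).
Hypotheses (r_gt0 : 0 < r) (LB : forall b, L b -> B b)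
  (LBr : forall b, L b -> B (b + r.+1)) (Bn : forall b, B b -> b + r < n).

Definition link1 (f : nat -> nat) b :=
  f (b + r.+1) < f b /\ f (b + r.+1).+1 = f b.+1.
Definition link2 (f : nat -> nat) b :=
  f (b + r.+1) = f b /\ f (b + r.+1).+1 < f b.+1.
Definition link3 (f : nat -> nat) b := f (b + r.+1) = f b.+1.

(* In the applications B is the set of first positions of blocks and L that of linked
   blocks. *)
Definition chained (link : (nat -> nat) -> nat -> Prop) (f : nat -> nat) :=
  (forall b, B b -> f b.+1 < f b /\ forall j, 0 < j <= r -> f (b + j) = f b.+1)
  /\ (forall b, L b -> link f b).

(** The inequality is weak because two windows may overlap in one letter, the last of one being the
    first of the other. *)
Definition separated :=
  (forall b b', B b -> B b' -> b < b' -> b + r <= b') /\ (forall b, L b -> ~~ B (b + r)).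

(** A head strictly inside the tail of another block would need a descent where that tail is
    constant. The hypothesis on [link], that the next head is not below the tail, excludes the last
    entry of a linked block too. *)
Lemma chained_separated (link : (nat -> nat) -> nat -> Prop) f :
    (forall b, link f b -> f b.+1 < f b -> f (b + r.+1).+1 < f (b + r.+1) ->
       f b.+1 <= f (b + r.+1)) ->
  chained link f -> separated.
Proof.
move=> Hlink [fB fL]; split=> [b b' Bb Bb' lt|b Lb].
  rewrite leqNgt; apply/negP => gt.
  have [_ tb] := fB _ Bb; have [hb' _] := fB _ Bb'.
  have E1 : f b' = f b.+1 by rewrite -(tb (b' - b)); [congr f|]; lia.
  have E2 : f b'.+1 = f b.+1 by rewrite -(tb (b'.+1 - b)); [congr f|]; lia.
  by move: hb'; rewrite E1 E2 ltnn.
(* A head at [b + r] has the next head [b + r.+1] as first tail entry, so that next head would lie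
   below the tail of [b]. *)
apply/negP => Bbr; have [hb tb] := fB _ (LB Lb); have [hbr _] := fB _ Bbr.
have [hq _] := fB _ (LBr Lb); have := Hlink _ (fL _ Lb) hb hq.
have := tb r; rewrite -addnS in hbr; lia.
Qed.

Lemma separated1 f : chained link1 f -> separated.
Proof. by apply: chained_separated => b [? ?]; lia. Qed.

Lemma separated2 f : chained link2 f -> separated.
Proof. by apply: chained_separated => b [? ?]; lia. Qed.

Lemma separated3 f : chained link3 f -> separated.
Proof. by apply: chained_separated => b; rewrite /link3 => ->. Qed.

(** * Reindexing tails: between the systems of Q1 and Q3 *)

Section Tails.

(** The ordinal [j] stands for the offset [j.+1] from the head; the test [j < x] keeps the truncated
    subtraction exact. *)
Definition tail_offset x := [pick j : 'I_r | (j < x) && L (x - j.+1)].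
Definition tail_to_head x := if tail_offset x is Some j then x - j.+1 + r.+1 else x.
Definition tail_next x := if tail_offset x is Some _ then x + r.+1 else x.
(* Every step from a linked tail is an increase, so n steps reach a fixed point. *)
Definition tail_end := iter n tail_next.

Lemma tail_spec x :
  (exists b j, [/\ L b, 0 < j <= r, x = b + j, tail_to_head x = b + r.+1 &
                   tail_next x = b + r.+1 + j]) \/
  [/\ forall b j, L b -> 0 < j <= r -> x <> b + j, tail_to_head x = x & tail_next x = x].
Proof.
rewrite /tail_to_head /tail_next /tail_offset; case: pickP => [j /andP[jx Lj]|N].
  by left; exists (x - j.+1), j.+1; split=> //; have := ltn_ord j; lia.
right; split=> // b j Lb jr Ex; have jr' : j.-1 < r by lia.
have := N (Ordinal jr'); rewrite /= (_ : x - j.-1.+1 = b) ?Lb ?andbT; lia.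
Qed.

Lemma tail_next_bound x : (tail_next x < n) = (x < n).
Proof.
have [[b [j [Lb jr Ex _ ->]]]|[_ _ ->//]] := tail_spec x.
by have := Bn (LBr Lb); lia.
Qed.

Lemma tail_to_head_bound x : (tail_to_head x < n) = (x < n).
Proof.
have [[b [j [Lb jr Ex -> _]]]|[_ -> //]] := tail_spec x.
by have := Bn (LBr Lb); lia.
Qed.

Lemma tail_end_bound x : (tail_end x < n) = (x < n).
Proof. by rewrite /tail_end; elim: {1}n => //= k IH; rewrite tail_next_bound. Qed.

Lemma tail_next_end x : tail_next (tail_end x) = tail_end x.
Proof.
have H k : tail_next (iter k tail_next x) = iter k tail_next x \/ k <= iter k tail_next x.
  elim: k => [|k [IH|IH]] /=; first by right.
    by left; rewrite IH IH.
  have [[b [j [Lb jr Ex _ E]]]|[_ _ E]] := tail_spec (iter k tail_next x); last by left; rewrite !E.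
  by right; lia.
(* A position that has reached n lies in no tail, because blocks end before n. *)
have {H}[//|le] := H n; rewrite -/(tail_end x) in le.
have [[b [j [Lb jr Ex _ E]]]|[_ _ ->//]] := tail_spec (tail_end x).
by have := Bn (LB Lb); lia.
Qed.

Lemma tail_end_next x : tail_end (tail_next x) = tail_end x.
Proof. by rewrite -[RHS]tail_next_end /tail_end -iterSr. Qed.

Lemma tail_end_id x : tail_next x = x -> tail_end x = x.
Proof. exact: iter_fix. Qed.

Lemma tail_to_head_id x : tail_next x = x -> tail_to_head x = x.
Proof. by have [[b [j [Lb jr Ex _ ->]]]|[_ -> //]] := tail_spec x; lia. Qed.

Hypothesis sep : separated.

(** By separation a head meets an earlier block only in its last entry, and then that block is
    unlinked. Hence reindexing tails leaves heads alone. *)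
Lemma head_fixed b : B b -> tail_next b = b.
Proof.
move=> Bb; have [[b0 [j [Lb jr Ex _ E]]]|[_ _ ->//]] := tail_spec b.
have [s1 s2] := sep; have lt : b0 < b by lia.
have := s1 _ _ (LB Lb) Bb lt; have := s2 _ Lb.
case: (eqVneq j r) => [jr'|]; [by rewrite -jr' -Ex Bb | lia].
Qed.

(** This uniqueness makes the choice of [pick] in [tail_offset] immaterial. *)
Lemma tail_in_block b b0 j j0 : B b -> L b0 -> 0 < j <= r -> 0 < j0 <= r ->
  b + j = b0 + j0 -> b = b0.
Proof.
move=> Bb Lb jr jr0 E; have [s1 s2] := sep.
case: (ltngtP b b0) => // lt.
  by have := s1 _ _ Bb (LB Lb) lt; have := s1 _ _ Bb (LBr Lb); lia.
have := s1 _ _ (LB Lb) Bb lt; have := s2 _ Lb.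
case: (eqVneq b (b0 + r)) => [<-|]; [by rewrite Bb | lia].
Qed.

Lemma tail_linked b j : L b -> 0 < j <= r ->
  tail_to_head (b + j) = b + r.+1 /\ tail_next (b + j) = b + r.+1 + j.
Proof.
move=> Lb jr; have [[b0 [j0 [Lb0 jr0 Ex -> ->]]]|[N _ _]] := tail_spec (b + j).
  have E := tail_in_block (LB Lb) Lb0 jr jr0 Ex.
  by split; lia.
by case: (N _ _ Lb jr).
Qed.

Lemma tail_unlinked b j : B b -> ~~ L b -> 0 < j <= r -> tail_next (b + j) = b + j.
Proof.
move=> Bb Lb jr; have [[b0 [j0 [Lb0 jr0 Ex _ _]]]|[_ _ ->//]] := tail_spec (b + j).
by case/negP: Lb; rewrite (tail_in_block Bb Lb0 jr jr0 Ex).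
Qed.

(** A linked tail takes the value of the next head, which [link1] puts below its own head; heads
    keep their values, so [link3] holds by construction. *)
Lemma tail_to_head_chained f f' :
  (forall x, f' x = f (tail_to_head x)) -> chained link1 f -> chained link3 f'.
Proof.
move=> E [fB fL].
have fhead b : B b -> f' b = f b by move=> Bb; rewrite E tail_to_head_id ?head_fixed.
have r1 : 0 < 1 <= r by lia.
split=> b Hb.
  have [hb tb] := fB _ Hb; rewrite (fhead b) // -[b.+1]addn1 E.
  case Lb : (L b).
    have [-> _] := tail_linked Lb r1; have [? _] := fL _ Lb.
    by split=> // j jr; rewrite E; have [-> _] := tail_linked Lb jr.
  have H j : 0 < j <= r -> tail_to_head (b + j) = b + j.
    by move=> jr; rewrite tail_to_head_id // tail_unlinked // Lb.
  rewrite H // addn1; split=> // j jr; rewrite E H //; exact: tb.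
rewrite /link3 fhead ?LBr // -[b.+1]addn1 E.
by have [-> _] := tail_linked Hb r1.
Qed.

(** The walk goes from block to block, with the same offset throughout. Under [link3] each next head
    equals a tail, so heads descend along it. *)
Lemma tail_end_block f b : chained link3 f -> B b ->
  exists b', [/\ B b', f b' <= f b & forall j, 0 < j <= r -> tail_end (b + j) = b' + j].
Proof.
move=> [fB fL] Bb; rewrite /tail_end; elim: {1}n => [|k [b' [Bb' le IH]]].
  by exists b; split=> //.
case Lb : (L b').
  exists (b' + r.+1); split; first exact: LBr.
    by rewrite (fL _ Lb); have [] := fB _ Bb'; lia.
  by move=> j jr; rewrite iterS IH //; have [_ ->] := tail_linked Lb jr.
exists b'; split=> // j jr; rewrite iterS IH // tail_unlinked // Lb //.
Qed.

(** All blocks of a chain receive the tail of its last block, which lies below the last head and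
    hence below every head of the chain. *)
Lemma tail_end_chained f f' :
  (forall x, f' x = f (tail_end x)) -> chained link3 f -> chained link1 f'.
Proof.
move=> E fP; have [fB fL] := fP.
have fhead b : B b -> f' b = f b by move=> Bb; rewrite E tail_end_id // head_fixed.
have r1 : 0 < 1 <= r by lia.
split=> b Hb.
  have [b' [Bb' le tb]] := tail_end_block fP Hb; have [hb' tb'] := fB _ Bb'.
  rewrite (fhead b) // -[b.+1]addn1 E tb // addn1; split; first by lia.
  by move=> j jr; rewrite E tb // tb'.
have [hb _] := fB _ (LB Hb); have lb := fL _ Hb.
split; first by rewrite !fhead ?LBr ?LB // lb.
rewrite -[b.+1]addn1 -[(b + r.+1).+1]addn1 !E -[tail_end (b + 1)]tail_end_next.
by have [_ ->] := tail_linked Hb r1.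
Qed.

(** [link1] makes [f] constant along [tail_next], and the end of a walk is not in a linked tail, so
    [tail_to_head] does not move it. *)
Lemma tail_to_headK f x : chained link1 f -> f (tail_to_head (tail_end x)) = f x.
Proof.
move=> [fB fL]; rewrite tail_to_head_id ?tail_next_end // /tail_end.
elim: {1}n => //= k <-; have [[b [j [Lb jr -> _ ->]]]|[_ _ ->//]] := tail_spec (iter k tail_next x).
have [_ ->] := fB _ (LBr Lb); last by [].
by have [_ ->] := fL _ Lb; have [_ ->] := fB _ (LB Lb).
Qed.

(** [tail_end] fixes heads, and by [link3] the next head has the value of the tail it replaces. *)
Lemma tail_endK f x : chained link3 f -> f (tail_end (tail_to_head x)) = f x.
Proof.
move=> [fB fL]; have [[b [j [Lb jr -> -> _]]]|[_ -> E]] := tail_spec x.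
  rewrite tail_end_id ?head_fixed ?LBr // fL //.
  by have [_ ->] := fB _ (LB Lb).
by rewrite tail_end_id.
Qed.

(** The value read at a linked tail comes from a later position, but it is below [f b] for the head
    [b] of the block, and [f b <= b <= x]. *)
Lemma tail_to_head_bounded f : chained link1 f -> (forall x, f x <= x) ->
  forall x, f (tail_to_head x) <= x.
Proof.
move=> [fB fL] fx x; have [[b [j [Lb jr -> -> _]]]|[_ -> _]] := tail_spec x => //.
by have [? _] := fL _ Lb; have := fx b; lia.
Qed.

Lemma tail_end_bounded f : chained link3 f -> (forall x, f x <= x) ->
  forall x, f (tail_end x) <= x.
Proof.
move=> fP fx x; have [fB fL] := fP.
have [[b [j [Lb jr -> _ _]]]|[_ _ E]] := tail_spec x; last by rewrite tail_end_id.
have [b' [Bb' le ->]] := tail_end_block fP (LB Lb); last by [].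
have [hb' ->] := fB _ Bb'; last by [].
by have := fx b; lia.
Qed.

End Tails.

(** * Reindexing heads: between the systems of Q2 and Q3 *)

Section Heads.

Definition head_linked x := (r < x) && L (x - r.+1).
Definition head_to_tail x := if head_linked x then x - r else x.
Definition head_prev x := if head_linked x then x - r.+1 else x.
Definition head_start := iter n head_prev.

Lemma head_spec x :
  (exists b, [/\ L b, x = b + r.+1, head_to_tail x = b.+1 & head_prev x = b]) \/
  [/\ forall b, L b -> x <> b + r.+1, head_to_tail x = x & head_prev x = x].
Proof.
rewrite /head_to_tail /head_prev /head_linked; case: ifP => [/andP[rx Lx]|N].
  by left; exists (x - r.+1); split=> //; lia.
by right; split=> // b Lb Ex; move: N; rewrite Ex addnK Lb; lia.
Qed.

Lemma head_linkedE b : L b ->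
  head_to_tail (b + r.+1) = b.+1 /\ head_prev (b + r.+1) = b.
Proof.
move=> Lb; have [[b0 [Lb0 Ex -> ->]]|[N _ _]] := head_spec (b + r.+1).
  by split; lia.
by case: (N _ Lb).
Qed.

Lemma head_prev_bound x : (head_prev x < n) = (x < n).
Proof.
have [[b [Lb Ex _ ->]]|[_ _ ->//]] := head_spec x.
by have := Bn (LBr Lb); lia.
Qed.

Lemma head_to_tail_bound x : (head_to_tail x < n) = (x < n).
Proof.
have [[b [Lb Ex -> _]]|[_ -> //]] := head_spec x.
by have := Bn (LBr Lb); lia.
Qed.

Lemma head_start_bound x : (head_start x < n) = (x < n).
Proof. by rewrite /head_start; elim: {1}n => //= k IH; rewrite head_prev_bound. Qed.

Lemma head_start_id x : head_prev x = x -> head_start x = x.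
Proof. exact: iter_fix. Qed.

Lemma head_prev_start x : head_prev (head_start x) = head_start x.
Proof.
(* From x >= n nothing moves, as blocks end before n. From x < n each proper step decreases the
   position, so there cannot be n of them. *)
have [xn|nx] := ltnP x n; last first.
  suff E : head_prev x = x by rewrite head_start_id.
  have [[b [Lb Ex _ _]]|[_ _ ->//]] := head_spec x.
  by have := Bn (LBr Lb); lia.
have H k : head_prev (iter k head_prev x) = iter k head_prev x \/ iter k head_prev x + k <= x.
  elim: k => [|k [IH|IH]] /=; first by right; rewrite addn0.
    by left; rewrite IH IH.
  have [[b [Lb Ex _ E]]|[_ _ E]] := head_spec (iter k head_prev x); last by left; rewrite !E.
  by right; lia.
have {H}[//|le] := H n; lia.
Qed.

Lemma head_start_prev x : head_start (head_prev x) = head_start x.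
Proof. by rewrite -[RHS]head_prev_start /head_start -iterSr. Qed.

Lemma head_to_tail_id x : head_prev x = x -> head_to_tail x = x.
Proof. by have [[b [Lb Ex _ ->]]|[_ -> //]] := head_spec x; lia. Qed.

Lemma head_start_le x : head_start x <= x.
Proof.
rewrite /head_start; elim: {1}n => //= k IH.
by have [[b [Lb Ex _ E]]|[_ _ E]] := head_spec (iter k head_prev x); lia.
Qed.

Hypothesis sep : separated.

(** If [b + j] were the head following a linked block [b0], separation would squeeze [b] to
    [b0 + r], which is not a head. *)
Lemma tail_fixed b j : B b -> 0 < j <= r -> head_prev (b + j) = b + j.
Proof.
move=> Bb jr; have [[b0 [Lb Ex _ _]]|[_ _ ->//]] := head_spec (b + j).
have [s1 s2] := sep; have lt : b0 < b by lia.
have := s1 _ _ (LB Lb) Bb lt; have := s1 _ _ Bb (LBr Lb); have := s2 _ Lb.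
by case: (eqVneq b (b0 + r)) => [<-|]; [rewrite Bb | lia].
Qed.

(** A linked head takes the tail of the block before it and stays above its own tail because tails
    decrease under [link2]. *)
Lemma head_to_tail_chained f f' :
  (forall x, f' x = f (head_to_tail x)) -> chained link2 f -> chained link3 f'.
Proof.
move=> E [fB fL].
have ftail b j : B b -> 0 < j <= r -> f' (b + j) = f (b + j).
  by move=> Bb jr; rewrite E head_to_tail_id // tail_fixed.
have ftail1 b : B b -> f' b.+1 = f b.+1.
  by move=> Bb; rewrite -addn1 ftail //; lia.
split=> b Hb; last first.
  by rewrite /link3 ftail1 ?LB // E; have [-> _] := head_linkedE Hb.
have [hb tb] := fB _ Hb; rewrite ftail1 //; split; last first.
  by move=> j jr; rewrite ftail // tb.
rewrite E; have [[b0 [Lb Ex -> _]]|[_ -> _]] := head_spec b; last by [].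
by have [_] := fL _ Lb; rewrite -Ex.
Qed.

Lemma head_prev_ge f x : chained link3 f -> f x <= f (head_prev x).
Proof.
move=> [fB fL]; have [[b [Lb -> _ ->]]|[_ _ -> //]] := head_spec x.
by rewrite (fL _ Lb); have [hb _] := fB _ (LB Lb); apply: ltnW.
Qed.

Lemma head_start_ge f x : chained link3 f -> f x <= f (head_start x).
Proof.
move=> fP; rewrite /head_start; elim: {1}n => //= k IH.
exact: leq_trans IH (head_prev_ge _ fP).
Qed.

(** The first head of a chain dominates its other heads under [link3], so the descents persist.
    Tails decrease because each next tail is below the next head, which equals the previous tail. *)
Lemma head_start_chained f f' :
  (forall x, f' x = f (head_start x)) -> chained link3 f -> chained link2 f'.
Proof.
move=> E fP; have [fB fL] := fP.
have ftail b j : B b -> 0 < j <= r -> f' (b + j) = f (b + j).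
  by move=> Bb jr; rewrite E head_start_id // tail_fixed.
have ftail1 b : B b -> f' b.+1 = f b.+1.
  by move=> Bb; rewrite -addn1 ftail //; lia.
split=> b Hb.
  have [hb tb] := fB _ Hb; rewrite ftail1 //; split; last first.
    by move=> j jr; rewrite ftail // tb.
  by rewrite E; apply: leq_trans hb (head_start_ge _ fP).
split; last first.
  rewrite (ftail1 _ (LB Hb)) (ftail1 _ (LBr Hb)).
  by have [] := fB _ (LBr Hb); rewrite (fL _ Hb).
by rewrite !E -[head_start (b + r.+1)]head_start_prev; have [_ ->] := head_linkedE Hb.
Qed.

Lemma head_to_tailK f x : chained link2 f -> f (head_to_tail (head_start x)) = f x.
Proof.
move=> [fB fL]; rewrite head_to_tail_id ?head_prev_start // /head_start.
elim: {1}n => //= k <-; have [[b [Lb -> _ ->]]|[_ _ ->//]] := head_spec (iter k head_prev x).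
by have [-> _] := fL _ Lb.
Qed.

Lemma head_startK f x : chained link3 f -> f (head_start (head_to_tail x)) = f x.
Proof.
move=> [fB fL]; have [[b [Lb -> -> _]]|[_ -> E]] := head_spec x.
  rewrite (fL _ Lb) -addn1 head_start_id // tail_fixed ?LB //; lia.
by rewrite head_start_id.
Qed.

(** Both head maps read at or before x, so the bound passes on. *)
Lemma head_to_tail_bounded f : (forall x, f x <= x) -> forall x, f (head_to_tail x) <= x.
Proof.
move=> fx x; apply: leq_trans (fx _) _.
by have [[b [Lb -> -> _]]|[_ -> _]] := head_spec x => //; lia.
Qed.

Lemma head_start_bounded f : (forall x, f x <= x) -> forall x, f (head_start x) <= x.
Proof. by move=> fx x; apply: leq_trans (fx _) (head_start_le _). Qed.

End Heads.
End Blocks.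

(** * Patterns cut into blocks *)

Section BlockPatterns.

Variables (r s : nat) (h t : nat -> nat).

(** The index i decreases from left to right, so block k from the left, counted from 0, has index
    [s - k.+1]. *)
Definition block_pattern := flatten [seq h i :: nseq r (t i) | i <- rev (iota 0 s)].

Lemma size_blocks (l : seq nat) :
  size (flatten [seq h i :: nseq r (t i) | i <- l]) = size l * r.+1.
Proof. by elim: l => //= i l IH; rewrite size_cat size_nseq IH mulSn addSn. Qed.

Lemma nth_blocks (l : seq nat) k j : k < size l -> j <= r ->
  nth 0 (flatten [seq h i :: nseq r (t i) | i <- l]) (k * r.+1 + j) =
  if j == 0 then h (nth 0 l k) else t (nth 0 l k).
Proof.
elim: l k => [|i l IH] [|k] // kl jr.
  by case: j jr {IH} => //= j jr; rewrite nth_cat size_nseq jr nth_nseq jr.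
rewrite mulSn !addSn /= nth_cat size_nseq ifF; last by lia.
by rewrite -IH //; congr nth; lia.
Qed.

Lemma size_block_pattern : size block_pattern = s * r.+1.
Proof. by rewrite size_blocks size_rev size_iota. Qed.

Lemma nth_block_pattern k j : k < s -> j <= r ->
  nth 0 block_pattern (k * r.+1 + j) = if j == 0 then h (s - k.+1) else t (s - k.+1).
Proof.
move=> ks jr; rewrite nth_blocks ?size_rev ?size_iota //.
by rewrite nth_rev ?size_iota // nth_iota ?add0n //; lia.
Qed.

Lemma mem_block_pattern x : 0 < r ->
  (x \in block_pattern) = has (fun i => (x == h i) || (x == t i)) (iota 0 s).
Proof.
move=> r_gt0; apply/flatten_mapP/hasP => -[i]; rewrite ?mem_rev => ip xi;
  exists i; rewrite ?mem_rev //.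
  by move: xi; rewrite inE mem_nseq r_gt0.
by rewrite inE mem_nseq r_gt0.
Qed.

Definition block_entry k j := if j == 0 then h (s - k.+1) else t (s - k.+1).

Variables (e : seq nat) (i : nat).

Let w := take (size block_pattern) (drop i e).
Let f := nth 0 e.

Lemma size_window : i + s * r.+1 <= size e -> size w = s * r.+1.
Proof. by move=> le; rewrite size_take size_drop size_block_pattern; case: ltnP; lia. Qed.

Lemma nth_window x : x < s * r.+1 -> nth 0 w x = f (i + x).
Proof. by move=> lt; rewrite nth_take ?size_block_pattern // nth_drop. Qed.

Lemma block_position k j : k < s -> j <= r -> k * r.+1 + j < s * r.+1.
Proof. by move=> ks jr; have : k.+1 * r.+1 <= s * r.+1; [rewrite leq_mul2r|]; lia. Qed.

Lemma reduction_window : 0 < s -> reduction w = block_pattern ->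
  i + s * r.+1 <= size e /\
  forall k j k' j', k < s -> j <= r -> k' < s -> j' <= r ->
    (f (i + k * r.+1 + j) < f (i + k' * r.+1 + j')) = (block_entry k j < block_entry k' j').
Proof.
move=> s_gt0 E.
have szw : size w = s * r.+1 by rewrite -size_block_pattern -E size_map.
split.
  (* Positivity turns a bound on the truncated difference [size e - i] into one on the sum. *)
  have : 0 < s * r.+1 by rewrite muln_gt0 s_gt0.
  by move: szw; rewrite size_take size_drop size_block_pattern; case: ltnP; lia.
move=> k j k' j' ks jr ks' jr'.
have lt := block_position ks jr; have lt' := block_position ks' jr'.
rewrite -!addnA -!nth_window // -ltn_reduction ?szw // E.
by rewrite !nth_block_pattern.
Qed.

Lemma window_reduction (v : nat -> nat) :
    i + s * r.+1 <= size e -> (forall x, (x \in block_pattern) = (x <= s)) ->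
    (forall x, x < s -> v x < v x.+1) ->
    (forall k j, k < s -> j <= r -> f (i + k * r.+1 + j) = v (block_entry k j)) ->
  reduction w = block_pattern.
Proof.
move=> le memP v_incr fE.
have -> : w = map v block_pattern.
  apply: (@eq_from_nth _ 0); rewrite size_window // ?size_map ?size_block_pattern //.
  move=> x lt; rewrite (nth_map 0) ?size_block_pattern // nth_window //.
  have ks : x %/ r.+1 < s by rewrite ltn_divLR.
  have jr : x %% r.+1 <= r by rewrite -ltnS ltn_mod.
  by rewrite (divn_eq x r.+1) nth_block_pattern // -fE // addnA.
apply: reduction_homo memP _ => x y xy ys.
elim: y xy ys => // y IH; rewrite ltnS leq_eqVlt => /orP[/eqP->|xy] ys; first exact: v_incr.
by apply: ltn_trans (v_incr _ ys); apply: IH => //; apply: ltnW.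
Qed.

End BlockPatterns.

Lemma Q1_block_pattern r s : Q1 r s = block_pattern r s succn (fun=> 0).
Proof. by rewrite /Q1 /block_pattern -[1]addn0 iotaDl -map_rev -map_comp. Qed.

Lemma Q2_block_pattern r s : Q2 r s = block_pattern r s (fun=> s) id.
Proof. by []. Qed.

(** The single letter closing each block [i^r i] of [Q3] is regrouped as the head of the following
    block. *)
Lemma Q3_block_pattern r s : 0 < s -> Q3 r s = block_pattern r s succn id.
Proof.
have iotaS m k : iota m k.+1 = rcons (iota m k) (m + k) by rewrite -addn1 iotaD cats1.
case: s => // s _; rewrite /Q3 /block_pattern [s.+1.-1]/=.
elim: s => [|s IH]; first by rewrite /= cats0.
rewrite (iotaS 0 s.+1) (iotaS 1 s) !rev_rcons !map_cons /= add1n add0n -IH.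
by rewrite -!catA.
Qed.

(** * Occurrences as chained windows *)

Section Windows.

Variables (r s : nat) (e : seq nat) (i : nat).
Hypotheses (r_gt0 : 0 < r) (s_gt0 : 0 < s).

Definition window_chained (link : (nat -> nat) -> nat -> Prop) (f : nat -> nat) :=
  (forall k, k < s -> f (i + k * r.+1).+1 < f (i + k * r.+1) /\
     forall j, 0 < j <= r -> f (i + k * r.+1 + j) = f (i + k * r.+1).+1)
  /\ (forall k, k.+1 < s -> link f (i + k * r.+1)).

Definition matches (p : seq nat) := reduction (take (size p) (drop i e)) = p.

Let f := nth 0 e.

(** The part common to the three patterns: comparisons within a block give a constant tail below the
    head. What remains for each pattern is to derive the links from the comparisons and to supply
    the increasing map [v] from letters to window entries. *)
Lemma matchesP h t link (v : nat -> nat) :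
    (forall x, (x \in block_pattern r s h t) = (x <= s)) ->
    (forall x, x < s -> t x < h x) ->
    ((forall k j k' j', k < s -> j <= r -> k' < s -> j' <= r ->
        (f (i + k * r.+1 + j) < f (i + k' * r.+1 + j')) =
        (block_entry s h t k j < block_entry s h t k' j')) ->
      forall k, k.+1 < s -> link f (i + k * r.+1)) ->
    (window_chained link f -> (forall x, x < s -> v x < v x.+1) /\
       forall k j, k < s -> j <= r -> f (i + k * r.+1 + j) = v (block_entry s h t k j)) ->
  matches (block_pattern r s h t) <-> i + s * r.+1 <= size e /\ window_chained link f.
Proof.
move=> memP th fwd bwd; split=> [m|[le wc]]; last first.
  by have [vi vE] := bwd wc; apply: window_reduction le memP vi vE.
have [le cmp] := reduction_window s_gt0 m; split=> //; split=> [k ks|]; last exact: fwd.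
split=> [|j jr].
  have := cmp k 1 k 0 ks r_gt0 ks (leq0n _); rewrite addn0 addn1 => ->.
  by apply: th; lia.
have [j0 jr'] : 0 < j /\ j <= r by apply/andP.
have A := cmp k 1 k j ks r_gt0 ks jr'; have A' := cmp k j k 1 ks jr' ks r_gt0.
move: A A'; rewrite /block_entry /= gtn_eqF // !addn1 !ltnn; by case: ltngtP.
Qed.

Lemma matches1 : matches (Q1 r s) <->
  i + s * r.+1 <= size e /\ window_chained (link1 r) f.
Proof.
rewrite Q1_block_pattern.
(* Letter 0 is the common tail, and a letter x > 0 is the head of block [s - x]. *)
apply: (matchesP (v := fun x => if x == 0 then f i.+1 else f (i + (s - x) * r.+1))) => //.
- move=> x; rewrite mem_block_pattern //; apply/hasP/idP => [[y]|xs].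
    by rewrite mem_iota => ? /orP[]/eqP->; lia.
  case: x xs => [|x] xs; [exists 0|exists x]; rewrite ?mem_iota ?eqxx ?orbT //; lia.
- move=> cmp k ks; have ks' := ltnW ks; split.
    have := cmp k.+1 0 k 0 ks (leq0n _) ks' (leq0n _).
    rewrite !addn0 mulSn [r.+1 + _]addnC addnA => ->; rewrite /block_entry /=; lia.
  have := cmp k.+1 1 k 1 ks r_gt0 ks' r_gt0; have := cmp k 1 k.+1 1 ks' r_gt0 ks r_gt0.
  rewrite !addn1 mulSn [r.+1 + _]addnC addnA /block_entry /= ltnn; lia.
- move=> [blk lnk].
  have base k : k < s -> f (i + k * r.+1).+1 = f i.+1.
    elim: k => [|k IH] ks; first by rewrite mul0n addn0.
    have [_] := lnk k ks; rewrite -addnA [_ + r.+1]addnC -mulSn => ->; apply: IH; lia.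
  split=> [[|x] xs|k j ks jr] /=.
    (* From letter 0 to letter 1: the descent in the last block, whose head is 1. *)
    rewrite -(base s.-1); last by lia.
    rewrite subn1; have [] := blk s.-1; lia.
    have [+ _] := lnk (s - x.+2) ltac:(lia).
    by rewrite -addnA [_ + r.+1]addnC -mulSn; have -> : (s - x.+2).+1 = s - x.+1 by lia.
  rewrite /block_entry; case: j jr => [|j] jr /=.
    by rewrite addn0; congr (f (i + _ * _)); lia.
  by rewrite -(base k) //; have [_ ->] := blk k ks.
Qed.

(** The map from letters to entries for [Q2] and [Q3], where every letter below s occurs as a
    tail. *)
Definition tail_value x := if x == s then f i else f (i + (s - x.+1) * r.+1).+1.

Lemma tail_value_incr :
    f i.+1 < f i ->
    (forall k, k.+1 < s -> f (i + k.+1 * r.+1).+1 < f (i + k * r.+1).+1) ->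
  forall x, x < s -> tail_value x < tail_value x.+1.
Proof.
move=> H0 H x xs; rewrite /tail_value ltn_eqF //; case: eqP => E.
  by rewrite E subnn mul0n addn0.
by have := H (s - x.+2) ltac:(lia); have -> : (s - x.+2).+1 = s - x.+1 by lia.
Qed.

Lemma tail_value_tail k : k < s -> f (i + k * r.+1).+1 = tail_value (s - k.+1).
Proof.
move=> ks; rewrite /tail_value ltn_eqF; last by lia.
by congr (f (i + _ * _).+1); lia.
Qed.

Lemma matches2 : matches (Q2 r s) <->
  i + s * r.+1 <= size e /\ window_chained (link2 r) f.
Proof.
rewrite Q2_block_pattern.
apply: (matchesP (v := tail_value)) => //.
- move=> x; rewrite mem_block_pattern //; apply/hasP/idP => [[y]|xs].
    by rewrite mem_iota => ? /orP[]/eqP->; lia.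
  have [->|ne] := eqVneq x s; first by exists 0; rewrite ?mem_iota ?eqxx.
  by exists x; rewrite ?mem_iota ?eqxx ?orbT //; lia.
- move=> cmp k ks; have ks' := ltnW ks; split.
    have := cmp k.+1 0 k 0 ks (leq0n _) ks' (leq0n _).
    have := cmp k 0 k.+1 0 ks' (leq0n _) ks (leq0n _).
    rewrite !addn0 mulSn [r.+1 + _]addnC addnA /block_entry /= ltnn; lia.
  have := cmp k.+1 1 k 1 ks r_gt0 ks' r_gt0.
  rewrite !addn1 mulSn [r.+1 + _]addnC addnA /block_entry /= => ->; lia.
- move=> [blk lnk].
  have base k : k < s -> f (i + k * r.+1) = f i.
    elim: k => [|k IH] ks; first by rewrite mul0n addn0.
    have [+ _] := lnk k ks; rewrite -addnA [_ + r.+1]addnC -mulSn => ->; apply: IH; lia.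
  split.
    apply: tail_value_incr => [|k ks]; first by have [] := blk 0 s_gt0; rewrite mul0n addn0.
    by have [_] := lnk k ks; rewrite -addnA [_ + r.+1]addnC -mulSn.
  move=> k j ks jr; rewrite /block_entry; case: j jr => [|j] jr /=.
    by rewrite /tail_value eqxx addn0 base.
  by rewrite -tail_value_tail //; have [_ ->] := blk k ks.
Qed.

Lemma matches3 : matches (Q3 r s) <->
  i + s * r.+1 <= size e /\ window_chained (link3 r) f.
Proof.
rewrite Q3_block_pattern //.
apply: (matchesP (v := tail_value)) => //.
- move=> x; rewrite mem_block_pattern //; apply/hasP/idP => [[y]|xs].
    by rewrite mem_iota => ? /orP[]/eqP->; lia.
  case: x xs => [|x] xs; [exists 0|exists x]; rewrite ?mem_iota ?eqxx ?orbT //; lia.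
- move=> cmp k ks; have ks' := ltnW ks; rewrite /link3.
  have := cmp k.+1 0 k 1 ks (leq0n _) ks' r_gt0.
  have := cmp k 1 k.+1 0 ks' r_gt0 ks (leq0n _).
  rewrite !addn0 !addn1 mulSn [r.+1 + _]addnC addnA /block_entry /=; lia.
- move=> [blk lnk].
  have next k : k.+1 < s -> f (i + k.+1 * r.+1) = f (i + k * r.+1).+1.
    by move=> ks; have := lnk k ks; rewrite /link3 -addnA [_ + r.+1]addnC -mulSn.
  split.
    apply: tail_value_incr => [|k ks]; first by have [] := blk 0 s_gt0; rewrite mul0n addn0.
    by rewrite -(next k ks); have [] := blk k.+1 ks.
  move=> k j ks jr; rewrite /block_entry; case: j jr => [|j] jr /=.
    (* A head other than the first carries the letter of the preceding tail. *)
    rewrite addn0 -[(s - k.+1).+1]subSn // subSS; case: k ks => [|k] ks.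
      by rewrite subn0 mul0n addn0 /tail_value eqxx.
    by rewrite next // tail_value_tail //; lia.
  by rewrite -tail_value_tail //; have [_ ->] := blk k ks.
Qed.

End Windows.

(** * Reindexing inversion sequences *)

Section Transfer.

Variable n : nat.
Implicit Types t : n.-tuple 'I_n.

Definition entry t := nth 0 (word t).

Lemma entry_ord t (i : 'I_n) : entry t i = tnth t i.
Proof. by rewrite /entry (nth_map i) ?size_tuple // -tnth_nth. Qed.

Lemma entry_default t x : n <= x -> entry t x = 0.
Proof. by move=> nx; rewrite /entry nth_default // size_map size_tuple. Qed.

Lemma entry_inj t t' : entry t =1 entry t' -> t = t'.
Proof. by move=> E; apply: eq_from_tnth => i; apply: val_inj; rewrite /= -!entry_ord. Qed.

Lemma is_invseqP t : reflect (forall x, entry t x <= x) (is_invseq t).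
Proof.
apply: (iffP forallP) => [H x|H i]; last by rewrite /= -entry_ord.
have [lt|le] := ltnP x n; last by rewrite entry_default.
by have := H (Ordinal lt); rewrite /= -entry_ord.
Qed.

(** The maps [a] in use preserve the positions below n, so the default of [insubd] is never
    taken. *)
Definition reindex (a : nat -> nat) t : n.-tuple 'I_n :=
  [tuple tnth t (insubd i (a i)) | i < n].

Lemma entry_reindex a t : (forall x, (a x < n) = (x < n)) ->
  forall x, entry (reindex a t) x = entry t (a x).
Proof.
move=> an x; have [lt|le] := ltnP x n; last first.
  by rewrite !entry_default // leqNgt an -leqNgt.
rewrite (entry_ord _ (Ordinal lt)) tnth_mktuple -entry_ord val_insubd /=.
by rewrite an lt.
Qed.

(** Reindexing by [a] and then by [a'] reads [t] at [a (a' x)], so the last hypothesis gives a left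
    inverse on [A]. *)
Lemma leq_card_reindex (A A' : {set n.-tuple 'I_n}) (a a' : nat -> nat) :
    (forall x, (a x < n) = (x < n)) -> (forall x, (a' x < n) = (x < n)) ->
    (forall t, t \in A -> reindex a t \in A') ->
    (forall t, t \in A -> forall x, entry t (a (a' x)) = entry t x) ->
  #|A| <= #|A'|.
Proof.
move=> an an' AA' K.
have inj : {in A &, injective (reindex a)}.
  apply: (can_in_inj (g := reindex a')) => t tA; apply: entry_inj => x.
  by rewrite !entry_reindex // K.
rewrite -(card_in_imset inj); apply: subset_leq_card.
by apply/subsetP=> _ /imsetP[t tA ->]; apply: AA'.
Qed.

Lemma card_reindex (PA PA' : (nat -> nat) -> Prop) (A A' : {set n.-tuple 'I_n})
    (a a' : nat -> nat) :
    (forall t, t \in A <-> (forall x, entry t x <= x) /\ PA (entry t)) ->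
    (forall t, t \in A' <-> (forall x, entry t x <= x) /\ PA' (entry t)) ->
    (forall x, (a x < n) = (x < n)) -> (forall x, (a' x < n) = (x < n)) ->
    (forall f, PA f -> (forall x, f x <= x) ->
       [/\ forall x, f (a x) <= x, forall f', (forall x, f' x = f (a x)) -> PA' f' &
           forall x, f (a (a' x)) = f x]) ->
    (forall f, PA' f -> (forall x, f x <= x) ->
       [/\ forall x, f (a' x) <= x, forall f', (forall x, f' x = f (a' x)) -> PA f' &
           forall x, f (a' (a x)) = f x]) ->
  #|A| = #|A'|.
Proof.
move=> AP AP' an an' H H'; apply/eqP; rewrite eqn_leq; apply/andP; split.
  apply: (leq_card_reindex an an') => t /AP[le Pt]; have [le' Pt' K] := H _ Pt le => //.
  apply/AP'; split=> [x|]; last by apply: Pt'; apply: entry_reindex.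
  by rewrite entry_reindex.
apply: (leq_card_reindex an' an) => t /AP'[le Pt]; have [le' Pt' K] := H' _ Pt le => //.
apply/AP; split=> [x|]; last by apply: Pt'; apply: entry_reindex.
by rewrite entry_reindex.
Qed.

End Transfer.

(** * Superset counts and the equivalences *)

Section Main.

Variables (r s n : nat) (T : {set 'I_n}).
Hypotheses (r_gt0 : 0 < r) (s_gt0 : 0 < s).

Definition block_start b := [exists t in T, exists k : 'I_s, b == t + k * r.+1].
Definition link_start b :=
  [exists t in T, exists k : 'I_s, (k.+1 < s) && (b == t + k * r.+1)].

Lemma link_start_block b : link_start b -> block_start b.
Proof.
case/exists_inP=> t tT /existsP[k /andP[_ E]]; apply/exists_inP; exists t => //.
by apply/existsP; exists k.
Qed.

Lemma link_start_next b : link_start b -> block_start (b + r.+1).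
Proof.
case/exists_inP=> t tT /existsP[k /andP[ks /eqP->]]; apply/exists_inP; exists t => //.
by apply/existsP; exists (Ordinal ks); rewrite /= mulSn; lia.
Qed.

Lemma block_start_bound : (forall t : 'I_n, t \in T -> t + s * r.+1 <= n) ->
  forall b, block_start b -> b + r < n.
Proof.
move=> rng b /exists_inP[t tT /existsP[k /eqP->]].
by have := rng _ tT; have := block_position (ltn_ord k) (leqnn r); lia.
Qed.

Lemma window_chainedP link f :
  (forall t : 'I_n, t \in T -> window_chained r s t link f) <->
  chained r block_start link_start link f.
Proof.
split=> [H|[fB fL] t tT].
  split=> b /exists_inP[t tT /existsP[k]].
    by move/eqP->; have [W _] := H _ tT; apply: W.
  by case/andP=> ks /eqP->; have [_ W] := H _ tT; apply: W.
split=> k ks.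
  apply: fB; apply/exists_inP; exists t => //.
  by apply/existsP; exists (Ordinal ks).
apply: fL; apply/exists_inP; exists t => //.
by apply/existsP; exists (Ordinal (ltnW ks)); rewrite /= ks eqxx.
Qed.

(** As [entry] is 0 from n on, the order relations could hold in a window that overruns the end; the
    range condition excludes this. *)
Definition superset_chained link f :=
  (forall i : 'I_n, i \in T -> i + s * r.+1 <= n) /\
  chained r block_start link_start link f.

Definition superset_seqs p :=
  [set t in [set t : n.-tuple 'I_n | is_invseq t] | T \subset Em n p (word t)].

Lemma mem_superset_seqs p link :
    (forall (e : seq nat) i, matches e i p <->
        i + s * r.+1 <= size e /\ window_chained r s i link (nth 0 e)) ->
  forall t, t \in superset_seqs p <-> 
    (forall x, entry t x <= x) /\ superset_chained link (entry t).
Proof.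
move=> mP t; rewrite /superset_chained !inE -window_chainedP.
have szw : size (word t) = n by rewrite size_map size_tuple.
split=> [/andP[/is_invseqP le /subsetP TE]|[le [rng W]]].
  have M (i : 'I_n) : i \in T ->
      i + s * r.+1 <= n /\ window_chained r s i link (entry t).
    by move/TE; rewrite inE => /eqP/mP; rewrite szw.
  by split=> //; split=> i /M[].
apply/andP; split; first exact/is_invseqP.
apply/subsetP=> i iT; rewrite inE; apply/eqP/mP; rewrite szw.
by split; [exact: rng|exact: W].
Qed.

Lemma card_superset13 : #|superset_seqs (Q1 r s)| = #|superset_seqs (Q3 r s)|.
Proof.
have P1 := mem_superset_seqs (fun e i => matches1 e i r_gt0 s_gt0).
have P3 := mem_superset_seqs (fun e i => matches3 e i r_gt0 s_gt0).
(* If a window of [T] overruns the end, both sets are empty. *)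
have [/forall_inP rng|/negP N] := boolP [forall t in T, t + s * r.+1 <= n]; last first.
  transitivity 0; [|symmetry]; apply: eq_card0 => t; apply: negbTE; apply/negP.
    by move/P1=> [_ [rng _]]; apply: N; apply/forall_inP.
  by move/P3=> [_ [rng _]]; apply: N; apply/forall_inP.
have Bn := block_start_bound rng; have LB := link_start_block; have LBr := link_start_next.
apply: (card_reindex (PA := superset_chained (link1 r))
  (PA' := superset_chained (link3 r))
  (a := tail_to_head r link_start) (a' := tail_end r n link_start) P1 P3).
- exact: tail_to_head_bound Bn.
- exact: tail_end_bound Bn.
- move=> f [_ fP] le; have sep := separated1 r_gt0 LB LBr fP; split.
  + exact: tail_to_head_bounded fP le.
  + by move=> f' E; split=> //; apply: tail_to_head_chained E fP.
  + by move=> x; apply: tail_to_headK fP.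
- move=> f [_ fP] le; have sep := separated3 r_gt0 LB LBr fP; split.
  + exact: tail_end_bounded fP le.
  + by move=> f' E; split=> //; apply: tail_end_chained E fP.
  + by move=> x; apply: tail_endK fP.
Qed.

Lemma card_superset23 : #|superset_seqs (Q2 r s)| = #|superset_seqs (Q3 r s)|.
Proof.
have P2 := mem_superset_seqs (fun e i => matches2 e i r_gt0 s_gt0).
have P3 := mem_superset_seqs (fun e i => matches3 e i r_gt0 s_gt0).
have [/forall_inP rng|/negP N] := boolP [forall t in T, t + s * r.+1 <= n]; last first.
  transitivity 0; [|symmetry]; apply: eq_card0 => t; apply: negbTE; apply/negP.
    by move/P2=> [_ [rng _]]; apply: N; apply/forall_inP.
  by move/P3=> [_ [rng _]]; apply: N; apply/forall_inP.
have Bn := block_start_bound rng; have LB := link_start_block; have LBr := link_start_next.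
apply: (card_reindex (PA := superset_chained (link2 r))
  (PA' := superset_chained (link3 r))
  (a := head_to_tail r link_start) (a' := head_start r n link_start) P2 P3).
- exact: head_to_tail_bound Bn.
- exact: head_start_bound Bn.
- move=> f [_ fP] le; have sep := separated2 r_gt0 LB LBr fP; split.
  + exact: head_to_tail_bounded le.
  + by move=> f' E; split=> //; apply: head_to_tail_chained E fP.
  + by move=> x; apply: head_to_tailK fP.
- move=> f [_ fP] le; have sep := separated3 r_gt0 LB LBr fP; split.
  + exact: head_start_bounded le.
  + by move=> f' E; split=> //; apply: head_start_chained E fP.
  + by move=> x; apply: head_startK fP.
Qed.

End Main.

Lemma super_strongly_Wilf_equiv_of_superset p q :
    (forall n (T : {set 'I_n}), #|superset_seqs T p| = #|superset_seqs T q|) ->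
  super_strongly_Wilf_equiv p q.
Proof.
move=> H n T.
have E p' : num_with_Em p' T =
    #|[set t in [set t : n.-tuple 'I_n | is_invseq t] | Em n p' (word t) == T]|.
  by apply: eq_card => t; rewrite !inE.
by rewrite !E; apply: card_exact_of_superset => T'; apply: H.
Qed.

Theorem mainTheorem7 (r s : nat) (hr : (1 <= r)%N) (hs : (2 <= s)%N) :
  [/\ super_strongly_Wilf_equiv (Q1 r s) (Q2 r s),
      super_strongly_Wilf_equiv (Q1 r s) (Q3 r s) &
      super_strongly_Wilf_equiv (Q2 r s) (Q3 r s)].
Proof.
have hs' : 0 < s by apply: ltnW.
split; apply: super_strongly_Wilf_equiv_of_superset => n T.
- by rewrite card_superset13 // card_superset23.
- exact: card_superset13.
- exact: card_superset23.
Qed.
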